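(* Let $\mathcal{A}=\{a_sG_s\}_{s=1}^k$ be an $m$-cover of an abelian group $G$ by left cosets. Then, for any $a\in G$ with $w_{\mathcal{A}}(a)=m$, we have $$N_a=\Big[G:\bigcap_{\substack{1\le s\le k\\ a\in a_sG_s}}G_s\Big]\le 2^{k-m}\quad\text{and furthermore}\quad k\ge m+f(N_a).$$ In particular, if $\{a_sG_s\}_{s\ne t}$ fails to be an $m$-cover of $G$, then we have the inequalities $$[G:G_t]\le 2^{k-m}\quad\text{and}\quad k\ge m+f([G:G_t]),$$ the bounds of which are best possible.
   Context: Here $m$ is a positive integer, $\mathcal{A}=\{a_sG_s\}_{s=1}^k$ is a finite system of left cosets of subgroups $G_1,\ldots,G_k$ of a group $G$ (with $a_1,\ldots,a_k\in G$; repetitions are allowed), $t$ denotes an element of $\{1,\ldots,k\}$, and $\{a_sG_s\}_{s\ne t}$ is the system obtained from $\mathcal{A}$ by deleting the coset $a_tG_t$ with index $t$. The covering function of $\mathcal{A}$ is $w_{\mathcal{A}}(x)=|\{1\le s\le k:\ x\in a_sG_s\}|$ for $x\in G$. The system $\mathcal{A}$ is called an $m$-cover of $G$ if $w_{\mathcal{A}}(x)\ge m$ for all $x\in G$ (and likewise for the system $\{a_sG_s\}_{s\ne t}$). The Mycielski function $f:\{1,2,3,\ldots\}\to\{0,1,2,\ldots\}$ is given by $f(n)=\sum_{p\in P(n)}\operatorname{ord}_p(n)(p-1)$, where $P(n)$ denotes the set of prime divisors of $n$ and $\operatorname{ord}_p(n)$ is the largest nonnegative integer $\alpha$ such that $p^{\alpha}\mid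 n$. For a subgroup $H$ of $G$, $[G:H]$ denotes the index of $H$ in $G$. *)

(* Defs.v *)
From mathcomp Require Import all_boot finmap.
From mathcomp Require Import boolp classical_sets functions cardinality.

Set Implicit Arguments.
Unset Strict Implicit.
Unset Printing Implicit Defensive.

Local Open Scope classical_set_scope.

Definition left_coset (G : groupType) (x : G) (H : set G) : set G :=
  [set (x * h)%g | h in H].

Definition left_cosets (G : groupType) (H : set G) : set (set G) :=
  range (fun x : G => left_coset x H).

Definition finite_index (G : groupType) (H : set G) : Prop :=
  finite_set (left_cosets H).

(* The value is 0 when the index is infinite, since fset_set sends infinite sets to
   the empty one, so it is only meaningful together with finite_index. *)
Definition subgroup_index (G : groupType) (H : set G) : nat :=
  #|` fset_set (left_cosets H)|%fset.

(* A system {a_s G_s} of k left cosets is given by the representatives a and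
   the subgroups H, indexed by 'I_k; the subgroups are the library's groupClosed
   predicates and [set` H s] is the underlying set of H s. *)
Definition covering_fun (G : groupType) (k : nat)
    (a : 'I_k -> G) (H : 'I_k -> groupClosed G) (x : G) : nat :=
  #|[pred s | x \in left_coset (a s) [set` H s]]|.

Definition is_cover (G : groupType) (m k : nat)
    (a : 'I_k -> G) (H : 'I_k -> groupClosed G) : Prop :=
  forall x : G, m <= covering_fun a H x.

(* lift t enumerates the indices different from t, so this says that deleting
   the coset of index t destroys the m-cover property. *)
Definition fails_without (G : groupType) (m k : nat)
    (a : 'I_k -> G) (H : 'I_k -> groupClosed G) (t : 'I_k) : Prop :=
  ~ is_cover m (fun s => a (lift t s)) (fun s => H (lift t s)).

Definition local_intersection (G : groupType) (k : nat)
    (a : 'I_k -> G) (H : 'I_k -> groupClosed G) (x : G) : set G :=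
  \bigcap_(s in [set s | left_coset (a s) [set` H s] x]) [set` H s].

Definition mycielski (n : nat) : nat :=
  \sum_(p <- primes n) logn p n * (p - 1).

(* Main.v *)
From HB Require Import structures.
Require Import Defs.
From mathcomp Require Import all_boot all_algebra all_fingroup all_solvable.
From mathcomp Require Import all_field all_character finmap.
From mathcomp Require Import boolp classical_sets functions cardinality.

(** Let [x] be covered exactly [m] times and let [K] be the intersection of the
    subgroups [H s] whose coset contains [x].  If [g] is not in [K], then
    [x * g] leaves one of the [m] cosets through [x], so, being covered [m]
    times, it lies in one of the other [k - m] cosets.  After translation by [x]
    everything follows from a statement about a single covering
    ([cosets_missing1_index]): if the complement of a subgroup [K] is covered by
    [n] cosets [b i * H i], none of which contains [1], then [K] has some finite
    index [N], [N <= 2 ^ n] and [mycielski N <= n].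

    That [K] has finite index is B. H. Neumann's lemma: in a covering of a group
    by finitely many cosets, those of subgroups of infinite index can be dropped
    ([neumann_cover]).  Dividing by the intersection of the subgroups that remain
    reduces the two inequalities to a finite abelian group [G]
    ([cosets_missing1_bounds]).  There, choose characters [chi i] of [G] trivial
    on [H i] with [z i := chi i (b i) != 1], and put
    [F := \prod_i (chi i - z i)].  This function vanishes on every coset
    [b i * H i], hence outside [K], while [F 1 = \prod_i (1 - z i)] is not zero.
    Its Fourier coefficients are algebraic integers, at most [2 ^ n] of which are
    nonzero; as [F] is supported on [K], the coefficient at a character depends
    only on the restriction of that character to [K], and every character of [K]
    is the restriction of exactly [N] characters of [G].  A nonzero coefficient
    is thus repeated [N] times, whence [N <= 2 ^ n], and [F 1], the sum of all
    the coefficients, is [N] times an algebraic integer.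

    The divisibility of [\prod_i (1 - z i)] by [N] yields the second inequality
    ([mycielski_leq_roots]): for a prime [p], the factor [(1 - z i) ^ (p - 1)]
    divides [p] if the order of [z i] is a power of [p], and otherwise divides an
    integer prime to [p].  So [logn p N * (p - 1)] is at most the number of
    those [i] for which the order of [z i] is a power of [p], and no [i] is
    counted for two primes.

    Both bounds are attained by coverings of the complement of [1] in a group,
    together with the trivial subgroup and [m.-1] copies of the whole group.  In a
    group of prime order [p] the [p - 1] singletons other than [[1]] form such a
    covering, and in direct products the orders of the groups are multiplied and
    the numbers of cosets added ([punctured_coverM]): a product of groups of
    order [2] gives the first bound, a product of groups whose prime orders
    multiply to [n] gives the second. *)

Set Implicit Arguments.
Unset Strict Implicit.
Unset Printing Implicit Defensive.

(** * Products of the 1 - z over roots of unity z *)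

Section Arith.
Import GRing.Theory Num.Theory.
Local Open Scope ring_scope.

Lemma dvdAP (e x : algC) :
  reflect (exists2 c, c \in Aint & x = c * e) (e %| x)%A.
Proof.
apply: (iffP idP) => [|[c Ac ->]]; last by rewrite -eqAmod0 eqAmodMl0.
rewrite unfold_in; case: eqP => [-> /eqP->|/eqP e0 Ae].
  by exists 0; rewrite ?rpred0 // mulr0.
by exists (x / e); rewrite ?divfK.
Qed.

Lemma dvdA_refl (x : algC) : (x %| x)%A.
Proof. by apply/dvdAP; exists 1; rewrite ?rpred1 ?mul1r. Qed.

Lemma dvdA_trans (y x z : algC) : (x %| y -> y %| z -> x %| z)%A.
Proof.
move=> /dvdAP[c Ac ->] /dvdAP[d Ad ->].
by apply/dvdAP; exists (d * c); rewrite ?rpredM ?mulrA.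
Qed.

Lemma dvdA_mul (x y z t : algC) : (x %| y -> z %| t -> x * z %| y * t)%A.
Proof.
move=> /dvdAP[c Ac ->] /dvdAP[d Ad ->].
by apply/dvdAP; exists (c * d); rewrite ?rpredM // mulrACA.
Qed.

Lemma dvdA_prod (I : Type) (r : seq I) (P : pred I) (F G : I -> algC) :
  (forall i, P i -> (F i %| G i)%A) ->
  (\prod_(i <- r | P i) F i %| \prod_(i <- r | P i) G i)%A.
Proof.
move=> dvFG; elim/big_ind2: _ => // [|x y z t]; first exact: dvdA_refl.
exact: dvdA_mul.
Qed.

Lemma dvdA_exp (x y : algC) n : (x %| y -> x ^+ n %| y ^+ n)%A.
Proof.
by move=> dvxy; elim: n => [|n IHn]; rewrite ?expr0 ?dvdA_refl // !exprS dvdA_mul.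
Qed.

Lemma dvdA_nat (a b : nat) : (a%:R %| b%:R)%A = (a %| b)%N.
Proof. by rewrite -eqAmod0_nat eqAmod0. Qed.

Lemma Aint_root_of_unity (z : algC) n : (0 < n)%N -> z ^+ n = 1 -> z \in Aint.
Proof. by move=> n0 zn; apply: (@Aint_unity_root n) => //; apply/unity_rootP. Qed.

Lemma dvdA_sub1_exp (z : algC) j : z \in Aint -> (1 - z %| 1 - z ^+ j)%A.
Proof.
move=> Az; apply/dvdAP; exists (\sum_(i < j) z ^+ i).
  by apply: rpred_sum => i _; apply: rpredX.
by rewrite -opprB subrX1 -[1 - z]opprB mulrN mulrC.
Qed.

(** The geometric sum of [z] vanishes, so [e] is the sum of the [1 - z ^+ j]. *)
Lemma dvdA_sub1_unity (z : algC) e :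
  (0 < e)%N -> z ^+ e = 1 -> z != 1 -> (1 - z %| e%:R)%A.
Proof.
move=> e0 ze z1; have Az := Aint_root_of_unity e0 ze.
have S0 : \sum_(j < e) z ^+ j = 0.
  have /eqP := subrX1 z e.
  by rewrite ze subrr eq_sym mulf_eq0 subr_eq0 (negPf z1) => /eqP.
have -> : e%:R = \sum_(j < e) (1 - z ^+ j).
  by rewrite sumrB S0 subr0 sumr_const card_ord.
by apply: rpred_sum => j _; apply: dvdA_sub1_exp.
Qed.

(** Evaluating the [p]-th cyclotomic polynomial at [1] gives
    [p = \prod_(0 < j < p) (1 - w ^+ j)]. *)
Lemma dvdA_sub1_prime (w : algC) p :
  prime p -> w ^+ p = 1 -> w != 1 -> ((1 - w) ^+ p.-1 %| p%:R)%A.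
Proof.
move=> p_pr wp w1; have p0 := prime_gt0 p_pr.
have Aw := Aint_root_of_unity p0 wp.
have prim_w : p.-primitive_root w.
  have [d prim_w dv_d] := prim_order_exists p0 wp.
  have [_ /(_ d dv_d)/pred2P[d1|<- //]] := primeP p_pr.
  by move/prim_expr_order: prim_w w1; rewrite d1 expr1 => ->; rewrite eqxx.
have := factor_Xn_sub_1 prim_w.
rewrite -{1 2}(prednK p0) big_nat_recl // expr0 subrX1 polyC1 prednK //.
move/(mulfI (monic_neq0 (monicXsubC 1))) => eq_p.
have -> : p%:R = \prod_(0 <= j < p.-1) (1 - w ^+ j.+1).
  rewrite -(eq_bigr _ (fun j _ => hornerXsubC (w ^+ j.+1) 1)) -horner_prod eq_p.
  rewrite horner_sum (eq_bigr (fun=> 1)) => [|j _]; last by rewrite hornerXn expr1n.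
  by rewrite sumr_const card_ord.
have -> : (1 - w) ^+ p.-1 = \prod_(0 <= j < p.-1) (1 - w).
  by rewrite prodr_const_nat subn0.
by apply: dvdA_prod => j _; apply: dvdA_sub1_exp.
Qed.

Lemma prim_order_gt1 (z : algC) d : d.-primitive_root z -> z != 1 -> (1 < d)%N.
Proof.
move=> prim_z z1; have := prim_expr_order prim_z; have := prim_order_gt0 prim_z.
by case: d {prim_z} => [|[|d]] //; rewrite expr1 => _ zE; rewrite zE eqxx in z1.
Qed.

(** If the order of [z] has a prime factor other than [p], a suitable power of
    [z] is a nontrivial root of unity of order prime to [p], and
    [dvdA_sub1_unity] applies to it; otherwise a power of [z] is a primitive
    [p]-th root of unity, and [dvdA_sub1_prime] does. *)
Lemma dvdA_sub1_order (z : algC) d p :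
    prime p -> d.-primitive_root z -> z != 1 ->
  exists2 e, coprime p e & ((1 - z) ^+ p.-1 %| (e * p ^ p.-nat d)%:R)%A.
Proof.
move=> p_pr prim_z z1; have d0 := prim_order_gt0 prim_z.
have zd := prim_expr_order prim_z; have Az := Aint_root_of_unity d0 zd.
have d1 := prim_order_gt1 prim_z z1.
case: (boolP (p.-nat d)) => [p_d | pN_d].
  exists 1%N; first exact: coprimen1.
  rewrite mul1n expn1; have [r dE] := p_natP p_d.
  have r0 : (0 < r)%N by move: d1; rewrite dE; case: (r).
  apply: dvdA_trans (dvdA_exp p.-1 (dvdA_sub1_exp (p ^ r.-1) Az)) _.
  apply: dvdA_sub1_prime => //; first by rewrite -exprM -expnSr prednK // -dE.
  rewrite -(prim_order_dvd prim_z) dE dvdn_Pexp2l ?prime_gt1 // -ltnNge.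
  by rewrite prednK.
exists (d`_p^' ^ p.-1)%N.
  exact/coprimeXr/(pnat_coprime (pnat_id p_pr) (part_pnat _ _)).
rewrite muln1 natrX; apply: dvdA_exp.
apply: dvdA_trans (dvdA_sub1_exp d`_p Az) _.
apply: dvdA_sub1_unity; first exact: part_gt0.
  by rewrite -exprM partnC.
rewrite -(prim_order_dvd prim_z); apply: contra pN_d => /(pnat_dvd) -> //.
exact: part_pnat.
Qed.

(** The [p - 1]-st power of the divisibility hypothesis, combined with
    [dvdA_sub1_order], says that [N ^ (p - 1)] divides [E * p ^ c], with [E] prime
    to [p] and [c] the number of [z i] whose order is a power of [p].  This is a
    divisibility of natural numbers, because a rational algebraic integer is an
    integer.  Since [z i != 1], each [z i] is counted for at most one [p]. *)
Lemma mycielski_leq_roots (I : finType) (z : I -> algC) (n N : nat) :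
    (0 < n)%N -> (forall i, z i ^+ n = 1) -> (forall i, z i != 1) ->
    (N%:R %| \prod_i (1 - z i))%A ->
  (mycielski N <= #|I|)%N.
Proof.
move=> n0 zn z1 dvN.
have /fin_all_exists[d prim_z] i : exists d, d.-primitive_root (z i).
  by have [d prim_d _] := prim_order_exists n0 (zn i); exists d.
have bound p : prime p -> (logn p N * (p - 1) <= #|[pred i | p.-nat (d i)]|)%N.
  move=> p_pr.
  have /fin_all_exists2[e co_e dv_e] i : exists2 e, coprime p e &
      ((1 - z i) ^+ p.-1 %| (e * p ^ p.-nat (d i))%:R)%A.
    exact: dvdA_sub1_order.
  set E := (\prod_i e i)%N; set c := #|_|.
  have co_E : coprime p E.
    rewrite /E; elim/big_rec: _ => [|i x _ co_x]; first exact: coprimen1.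
    by rewrite coprimeMr co_e.
  have E0 : (0 < E)%N.
    case: posnP co_E => // ->; rewrite /coprime gcdn0 => /eqP p1.
    by rewrite p1 in p_pr.
  have dvNE : (N ^ p.-1 %| E * p ^ c)%N.
    rewrite -dvdA_nat natrX.
    apply: dvdA_trans (dvdA_exp _ dvN) _; rewrite -prodrXl.
    have -> : (E * p ^ c)%:R = \prod_i (e i * p ^ p.-nat (d i))%:R :> algC.
      rewrite -natr_prod big_split /=; congr (_ * _)%:R.
      rewrite -expn_sum; congr (_ ^ _)%N; rewrite /c -sum1_card big_mkcond /=.
      by apply: eq_bigr => i _; rewrite inE; case: ifP.
    by apply: dvdA_prod.
  have pc0 : (0 < p ^ c)%N by rewrite expn_gt0 prime_gt0.
  have := dvdn_leq_log p _ dvNE; rewrite muln_gt0 E0 pc0 => /(_ isT).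
  by rewrite lognM // (logn_coprime co_E) pfactorK // lognX subn1 mulnC.
(* if the order [d i > 1] is a power of [p], then [p = pdiv (d i)] *)
rewrite /mycielski.
apply: (@leq_trans (\sum_(p <- primes N) #|[pred i | pdiv (d i) == p]|)%N).
  rewrite big_seq [leqRHS]big_seq; apply: leq_sum => p.
  rewrite mem_primes => /and3P[p_pr _ _]; apply: leq_trans (bound p p_pr) _.
  apply/subset_leq_card/fintype.subsetP => i; rewrite !inE => p_d.
  have d1 := prim_order_gt1 (prim_z i) (z1 i).
  exact: (pnatPpi p_d (etrans (pi_pdiv _) d1)).
rewrite -[leqRHS]sum1_card.
under eq_bigr do rewrite -sum1_card big_mkcond.
rewrite exchange_big; apply: leq_sum => i _ /=.
rewrite -big_mkcond /= sum1_count.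
rewrite (eq_count (_ : _ =1 pred1 (pdiv (d i)))); last first.
  by move=> p; rewrite /= !inE eq_sym.
by rewrite count_uniq_mem ?primes_uniq // leq_b1.
Qed.

End Arith.

(** * Coverings of finite abelian groups *)

Section FiniteGroup.
Import GRing.Theory Num.Theory.
Local Open Scope ring_scope.

Variables (gT : finGroupType) (G K : {group gT}).
Hypotheses (abelG : abelian G) (sKG : K \subset G).

Lemma irr_lin_char (l : Iirr G) : 'chi_l \is a linear_char.
Proof. exact/char_abelianP. Qed.

Lemma Res_IirrE (l : Iirr G) : 'chi_(Res_Iirr K l) = 'Res[K] 'chi_l.
Proof. by rewrite lin_Res_IirrE // lin_char1 ?irr_lin_char. Qed.

(** The characters of [G] extending ['chi_t] are the constituents of
    ['Ind[G] 'chi_t], whose degree is the index of [K]. *)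
Lemma card_Res_Iirr (t : Iirr K) :
  #|[pred l : Iirr G | Res_Iirr K l == t]| = #|G : K|%g.
Proof.
apply/eqP; rewrite -(eqr_nat algC); apply/eqP.
have abelK := abelianS sKG abelG.
have <- : 'Ind[G] 'chi_t 1%g = #|G : K|%g%:R.
  by rewrite cfInd1 // lin_char1 ?mulr1 //; apply/char_abelianP.
rewrite (cfun_sum_cfdot ('Ind[G] 'chi_t)) sum_cfunE.
rewrite -sum1_card natr_sum big_mkcond /=.
apply: eq_bigr => l _; rewrite cfunE lin_char1 ?irr_lin_char // mulr1.
rewrite -Frobenius_reciprocity -Res_IirrE cfdot_irr inE eq_sym.
by case: eqP.
Qed.

Section SupportedOnSubgroup.

Variable F : 'CF(G).
Hypotheses (F_Aint : forall l, '[F, 'chi_l] \in Aint).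
Hypothesis F_supp : {in G :\: K, forall x, F x = 0}.

(** The inner product is a sum over [K], where the two characters agree. *)
Lemma cfdot_Res_eq (l1 l2 : Iirr G) :
  Res_Iirr K l1 = Res_Iirr K l2 -> '[F, 'chi_l1] = '[F, 'chi_l2].
Proof.
move=> eqRes; rewrite !cfdotE; congr (_ * _); apply: eq_bigr => x Gx.
have [Kx | notKx] := boolP (x \in K); last first.
  by rewrite F_supp ?inE ?notKx // !mul0r.
have chiE (l : Iirr G) : 'chi_l x = 'chi_(Res_Iirr K l) x.
  by rewrite Res_IirrE cfResE.
by rewrite (chiE l1) (chiE l2) eqRes.
Qed.

Lemma cfun1_sum_cfdot : F 1%g = \sum_l '[F, 'chi_l].
Proof.
rewrite {1}[F]cfun_sum_cfdot sum_cfunE; apply: eq_bigr => l _.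
by rewrite cfunE lin_char1 ?irr_lin_char // mulr1.
Qed.

(** The value at [1] is the sum of the coefficients, which are constant on the
    fibres of restriction to [K], each of which has [#|G : K|%g] elements. *)
Lemma dvdA_index_cfun1 : (#|G : K|%g%:R %| F 1%g)%A.
Proof.
rewrite cfun1_sum_cfdot (partition_big (Res_Iirr K) xpredT) //=.
apply: rpred_sum => t _.
have [l0 /eqP l0t | no_l] := pickP (fun l : Iirr G => Res_Iirr K l == t).
  rewrite (eq_bigr (fun=> '[F, 'chi_l0])) => [|l /eqP lt]; last first.
    by apply: cfdot_Res_eq; rewrite lt.
  rewrite sumr_const card_Res_Iirr.
  by apply/dvdAP; exists '[F, 'chi_l0]; rewrite ?mulr_natr.
by rewrite (eq_bigl _ _ no_l) big_pred0_eq rpred0.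
Qed.

(** Some coefficient is nonzero, so all those in its fibre are. *)
Lemma leq_index_card_constt (S : {set Iirr G}) :
  F 1%g != 0 -> irr_constt F \subset S -> (#|G : K|%g <= #|S|)%N.
Proof.
move=> F1 sFS; have [l0 cl0] : exists l, '[F, 'chi_l] != 0.
  apply/existsP; apply: contraR F1; rewrite negb_exists => /forallP c0.
  by rewrite cfun1_sum_cfdot big1 // => l _; apply/eqP; have := c0 l; rewrite negbK.
rewrite -(card_Res_Iirr (Res_Iirr K l0)); apply: subset_leq_card.
apply/fintype.subsetP => l; rewrite inE => /eqP eq_l.
by apply: (fintype.subsetP sFS); rewrite inE (cfdot_Res_eq eq_l).
Qed.

End SupportedOnSubgroup.

(** Each of the [2 ^ #|I|] terms of the expanded product is a scalar multiple of
    a character. *)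
Lemma prod_char_sub_cst (I : finType) (x : I -> Iirr G) (z : I -> algC) :
    (forall i, z i \in Aint) ->
  exists2 l : {set I} -> Iirr G,
    forall j, '[\prod_i ('chi_(x i) - (z i)%:A), 'chi_j] \in Aint
    & irr_constt (\prod_i ('chi_(x i) - (z i)%:A)) \subset [set l J | J : {set I}].
Proof.
move=> Az.
pose l (J : {set I}) := cfIirr (\prod_(i in J) 'chi_(x i)).
have lE J : 'chi_(l J) = \prod_(i in J) 'chi_(x i).
  by apply/cfIirrE/lin_char_irr/rpred_prod => i _; apply: irr_lin_char.
pose c (J : {set I}) := \prod_(i in ~: J) - z i.
have -> : \prod_i ('chi_(x i) - (z i)%:A) = \sum_J c J *: 'chi_(l J).
  rewrite bigA_distr; apply: eq_bigr => J _; rewrite lE.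
  rewrite (bigID (mem J)) /= -mulr_algl mulrC; congr (_ * _).
    rewrite -in_algE rmorph_prod /=.
    by apply: eq_big => [i|i /negPf->]; rewrite ?inE ?scaleNr.
  by apply: eq_bigr => i ->.
have cE j : '[\sum_J c J *: 'chi_(l J), 'chi_j] = \sum_J c J * (l J == j)%:R.
  by rewrite cfdot_suml; apply: eq_bigr => J _; rewrite cfdotZl cfdot_irr.
exists l => [j|]; first rewrite cE.
  apply: rpred_sum => J _; rewrite rpredM ?rpred_nat //.
  by apply: rpred_prod => i _; rewrite rpredN.
apply/fintype.subsetP => j; rewrite inE /= cE; apply: contraR => notlj.
apply/eqP/big1 => J _; case: eqP => [lJ|]; last by rewrite mulr0.
by rewrite -lJ imset_f in notlj.
Qed.

(** The function [F] below is the product of the [chi i - z i], where [chi i] is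
    a character trivial on [H i] and [z i = chi i (b i) != 1]; it vanishes outside
    [K] because the cosets cover [G :\: K]. *)
Theorem cosets_missing1_bounds (I : finType) (b : I -> gT) (H : I -> {group gT}) :
    (forall i, H i \subset G) -> (forall i, b i \in G) ->
    (forall i, b i \notin H i) ->
    {in G :\: K, forall x, exists i, x \in (b i *: H i)%g} ->
  (#|G : K|%g <= 2 ^ #|I|)%N /\ (mycielski #|G : K|%g <= #|I|)%N.
Proof.
move=> sHG Gb notHb cov.
have /fin_all_exists[x /all_and2[Hx bx]] i :
    exists l : Iirr G, H i \subset cfker 'chi_l /\ 'chi_l (b i) != 1.
  have nHG : (H i <| G)%g by rewrite -sub_abelian_normal.
  have := notHb i; rewrite -{1}(cap_cfker_normal nHG) => not_cap.
  have [/existsP[l /andP[]]|no_l] :=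
      boolP [exists l : Iirr G, (H i \subset cfker 'chi_l) && ('chi_l (b i) != 1)].
    by exists l.
  case/finset.bigcapP: not_cap => l Hl; move: no_l.
  rewrite negb_exists => /forallP/(_ l); rewrite Hl negbK => /eqP chi_b.
  by rewrite cfkerEirr inE chi_b lin_char1 ?irr_lin_char.
pose z i := 'chi_(x i) (b i).
have z_unity i : z i ^+ #|G| = 1.
  rewrite -lin_charX ?irr_lin_char // (_ : b i ^+ #|G| = 1)%g.
    by rewrite lin_char1 ?irr_lin_char.
  exact: expg_cardG (Gb i).
have Az i : z i \in Aint by apply: Aint_root_of_unity (z_unity i).
pose F : 'CF(G) := \prod_i ('chi_(x i) - (z i)%:A).
have FE y : y \in G -> F y = \prod_i ('chi_(x i) y - z i).
  move=> Gy; rewrite prod_cfunE //; apply: eq_bigr => i _.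
  by rewrite !cfunE cfun1E Gy mulr1.
have F_supp : {in G :\: K, forall y, F y = 0}.
  move=> y GKy; have /cov[i] := GKy; case/lcosetP=> h Hh ->.
  have Gh := fintype.subsetP (sHG i) h Hh.
  rewrite FE ?groupM // (bigD1 i) //= lin_charM ?irr_lin_char //.
  have /fintype.subsetP/(_ h Hh) := Hx i; rewrite cfkerEirr inE => /eqP ->.
  by rewrite lin_char1 ?irr_lin_char // mulr1 subrr mul0r.
have F1 : F 1%g = \prod_i (1 - z i).
  by rewrite FE //; apply: eq_bigr => i _; rewrite lin_char1 ?irr_lin_char.
have F1_neq0 : F 1%g != 0.
  by rewrite F1; apply/prodf_neq0 => i _; rewrite subr_eq0 eq_sym; apply: bx.
have [l F_Aint sFl] := prod_char_sub_cst x Az.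
split.
  apply: leq_trans (leq_index_card_constt F_supp F1_neq0 sFl) _.
  apply: leq_trans (leq_imset_card _ _) _.
  by rewrite -(cardsT I) -card_powerset finset.powersetT cardsT.
apply: (mycielski_leq_roots (cardG_gt0 G) z_unity bx).
by rewrite -F1; apply: dvdA_index_cfun1.
Qed.

End FiniteGroup.

Local Open Scope classical_set_scope.

(** * Subgroups of finite index *)

(** A predicate on bare sets, because intersections of families of subgroups are
    only given as sets. *)
Definition is_subgroup (G : groupType) (H : set G) : Prop :=
  H 1%g /\ forall x y, H x -> H y -> H (x^-1 * y)%g.

Section Index.
Variable G : groupType.
Implicit Types (H : set G) (x y : G).

Lemma left_cosetE H x : left_coset x H = [set y | H (x^-1 * y)%g].
Proof.
apply/seteqP; split=> [_ [h Hh <-]|y Hxy] /=; first by rewrite mulKg.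
by exists (x^-1 * y)%g; rewrite ?mulVKg.
Qed.

Section Subgroup.
Variable H : set G.
Hypothesis sgH : is_subgroup H.

Lemma subgroup1 : H 1%g. Proof. by case: sgH. Qed.

Lemma subgroup_divl x y : H x -> H y -> H (x^-1 * y)%g.
Proof. by case: sgH => _; apply. Qed.

Lemma subgroupV x : H x -> H x^-1%g.
Proof. by move=> Hx; rewrite -[x^-1%g]mulg1; apply: subgroup_divl subgroup1. Qed.

Lemma subgroupM x y : H x -> H y -> H (x * y)%g.
Proof. by move=> Hx Hy; rewrite -[x]invgK; apply/subgroup_divl/Hy/subgroupV. Qed.

Lemma subgroup_sym x y : H (x^-1 * y)%g -> H (y^-1 * x)%g.
Proof. by move/subgroupV; rewrite invgM invgK. Qed.

Lemma subgroup_trans x y z : H (x^-1 * y)%g -> H (y^-1 * z)%g -> H (x^-1 * z)%g.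
Proof. by move=> Hxy /(subgroupM Hxy); rewrite -mulgA mulVKg. Qed.

Lemma eq_left_coset x y : left_coset x H = left_coset y H <-> H (x^-1 * y)%g.
Proof.
rewrite !left_cosetE; split=> [eqxy|Hxy].
  have : [set z | H (y^-1 * z)%g] y by rewrite /= mulVg; apply: subgroup1.
  by rewrite -eqxy.
by apply/seteqP; split=> z /=; apply: subgroup_trans => //; apply: subgroup_sym.
Qed.

Lemma finite_index_separated (T : finType) (f : G -> T) :
  (forall x y, f x = f y -> H (x^-1 * y)%g) -> finite_index H.
Proof.
move=> fH; pose rep t := xget 1%g [set x | f x = t].
apply: (@sub_finite_set _ _ [set left_coset (rep t) H | t in [set: T]]).
  move=> _ [x _ <-]; exists (f x) => //; apply/eq_left_coset/fH.
  by rewrite /rep; case: xgetP => [y _ //|/(_ x)[]].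
exact/finite_image/finite_finset.
Qed.

(** The left cosets of [H] are the nonempty fibres of [f]. *)
Lemma subgroup_index_fibers (T : finType) (f : G -> T) (A : {set T}) :
    (forall x y, f x = f y <-> H (x^-1 * y)%g) ->
    (forall t, t \in A <-> exists x, f x = t) ->
  subgroup_index H = #|A|.
Proof.
move=> fH fA; apply: card_fset_set.
have -> : left_cosets H =
    [set f @^-1` [set t] | t in [set` [fset t in enum A]%fset]].
  have cosetE x : left_coset x H = f @^-1` [set f x].
    rewrite left_cosetE; apply/seteqP; split=> y /=; first by move/fH.
    by move/esym/fH.
  apply/seteqP; split=> [_ [x _ <-]|_ [t At <-]].
    by exists (f x); rewrite ?cosetE //= inE mem_enum; apply/fA; exists x.
  move: At; rewrite /= inE mem_enum => /fA[x <-].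
  by exists x; rewrite ?cosetE.
apply: card_eq_trans (inj_card_eq _) _ => [t u|]; last first.
  by apply/card_eq_fsetP; rewrite card_fseq undup_id ?enum_uniq // -cardE.
rewrite !inE /= !inE !mem_enum => /fA[x <-] /fA[y <-].
move=> eq_xy; have : (f @^-1` [set f x]) x by [].
by rewrite eq_xy.
Qed.

(** [T] is the set of left cosets, [c] the projection and [r] a choice of
    representatives. *)
Lemma left_cosets_classes : finite_index H ->
  exists (T : finType) (c : G -> T) (r : T -> G),
    (forall x y, c x = c y <-> H (x^-1 * y)%g) /\ cancel r c.
Proof.
move=> finH; pose T : finType := fset_set (left_cosets H).
have cP x : left_coset x H \in fset_set (left_cosets H).
  by rewrite in_fset_set // inE; exists x.
pose c x : T := [` cP x]%fset.
have /fin_all_exists[r rK] (t : T) : exists x, c x = t.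
  have := valP t; rewrite in_fset_set // inE => -[x _ xt].
  by exists x; apply: val_inj.
exists T, c, r; split=> // x y; rewrite -eq_left_coset.
by split=> [/(congr1 val) //|eq_xy]; apply: val_inj.
Qed.

End Subgroup.

Lemma is_subgroup_bigcap (I : Type) (P : set I) (H : I -> set G) :
  (forall i, P i -> is_subgroup (H i)) -> is_subgroup (\bigcap_(i in P) H i).
Proof.
move=> sgH; split=> [i Pi|x y Hx Hy i Pi]; first exact: subgroup1 (sgH i Pi).
by apply: (subgroup_divl (sgH i Pi)); [apply: Hx|apply: Hy].
Qed.

Lemma finite_index_bigcap (I : finType) (P : set I) (H : I -> set G) :
    (forall i, P i -> is_subgroup (H i)) -> (forall i, P i -> finite_index (H i)) ->
  finite_index (\bigcap_(i in P) H i).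
Proof.
move=> sgH finH.
have /fin_all_exists[T /fin_all_exists[c cH]] i : exists (T : finType) (c : G -> T),
    P i -> forall x y, c x = c y -> H i (x^-1 * y)%g.
  have [Pi|nPi] := pselect (P i); last by exists unit, (fun=> tt).
  have [T [c [r [cH _]]]] := left_cosets_classes (sgH i Pi) (finH i Pi).
  by exists T, c => _ x y /cH.
pose f x : {dffun forall i, T i} := [ffun i => c i x].
apply: (finite_index_separated (is_subgroup_bigcap sgH) (f := f)) => x y eq_f i Pi.
apply: cH => //.
by have := congr1 (fun g : {dffun forall i, T i} => g i) eq_f; rewrite !ffunE.
Qed.

End Index.

(** * Neumann's lemma *)

Section Neumann.
Variables (G : groupType) (I : finType) (H : I -> set G).
Hypothesis sgH : forall i, is_subgroup (H i).

(** Induction on [J].  If the cosets of [H j] alone do not cover [G], they miss a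
    coset [g * H j], which the cosets of the other subgroups therefore cover.
    Each coset of [H j] is a translate of [g * H j], so it can be replaced in the
    covering by translates of cosets of the other subgroups, and [j] can be
    removed from [J]. *)
Lemma neumann_finite_index (J : {set I}) (s : seq (G * I)) :
    {in s, forall p, p.2 \in J} ->
    (forall x, exists2 p, p \in s & H p.2 (p.1^-1 * x)%g) ->
  exists2 i, i \in J & finite_index (H i).
Proof.
have [n] := ubnP #|J|; elim: n J s => // n IHn J s /ltnSE leJn sJ cov.
have [p0 p0s _] := cov 1%g; set j := p0.2; have Jj : j \in J by apply: sJ.
have [covj|] := pselect (forall g, exists2 p, p \in s & H j (p.1^-1 * g)%g).
  exists j => //.
  apply: (@sub_finite_set _ _ [set left_coset p.1 (H j) | p in [set` s]]).
    move=> _ [x _ <-]; have [p ps Hp] := covj x.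
    by exists p => //; apply/eq_left_coset.
  exact/finite_image/finite_seq.
move=> /existsNP[g not_covj].
pose s2 := [seq q <- s | q.2 != j].
pose s1 := [seq (p.1 * g^-1 * q.1, q.2)%g | p <- s, q <- s2].
have [|||i] := IHn (J :\ j)%SET (s2 ++ s1).
- by apply: leq_trans leJn; rewrite [leqRHS](cardsD1 j) Jj.
- move=> p; rewrite mem_cat => /orP[|/allpairsP[[q r] [/= _]]].
    by rewrite mem_filter !inE => /andP[-> /sJ].
  by rewrite mem_filter => /andP[rj /sJ Jr] ->; rewrite !inE rj.
- move=> x; have [p ps Hpx] := cov x; have [pj|pj] := eqVneq p.2 j; last first.
    by exists p => //; rewrite mem_cat mem_filter pj ps.
  (* [x] lies in [p.1 * H j]; move it into the uncovered coset [g * H j] *)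
  have [q qs Hq] := cov (g * (p.1^-1 * x))%g.
  have qj : q.2 != j.
    apply/eqP => qj; apply: not_covj; exists q => //.
    move: Hpx Hq; rewrite pj qj; move: (_ * x)%g => h Hh Hq.
    have := subgroupM (sgH j) Hq (subgroupV (sgH j) Hh).
    by rewrite -!mulgA mulgV mulg1.
  exists (p.1 * g^-1 * q.1, q.2)%g; last by rewrite /= !invgM invgK -!mulgA.
  rewrite mem_cat; apply/orP; right; apply/allpairsP; exists (p, q).
  by rewrite mem_filter qj.
by rewrite !inE => /andP[_ Ji] finHi; exists i.
Qed.

(** Suppose that no coset of a finite-index [H i] contains [x], and let [D] be
    the intersection of the finite-index [H i].  Then none of those cosets meets
    [x * D], which is thus covered by the other cosets.  As finitely many
    translates of [x * D] cover [G], so do finitely many cosets of the [H i] of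
    infinite index, contradicting [neumann_finite_index]. *)
Lemma neumann_cover (b : I -> G) :
    (forall x, exists i, H i ((b i)^-1 * x)%g) ->
  forall x, exists2 i, finite_index (H i) & H i ((b i)^-1 * x)%g.
Proof.
move=> cov x; apply: contrapT => not_cov.
pose D := \bigcap_(i in [set i | finite_index (H i)]) H i.
have sgD : is_subgroup D by apply: is_subgroup_bigcap => i _.
have finD : finite_index D by apply: finite_index_bigcap.
have [T [c [r [cD rK]]]] := left_cosets_classes sgD finD.
pose J := [set i | ~~ `[< finite_index (H i) >]]%SET.
pose s := [seq (r t * x^-1 * b i, i)%g | t <- enum T, i <- enum J].
have [||i] := @neumann_finite_index J s.
- by move=> p /allpairsP[[t i] [_ /= iJ ->]]; rewrite mem_enum in iJ.
- move=> y; pose t := c y.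
  have Dty : D ((r t)^-1 * y)%g by apply/cD; rewrite rK.
  have [i Hi] := cov (x * ((r t)^-1 * y))%g.
  exists (r t * x^-1 * b i, i)%g; last first.
    by rewrite /= !invgM invgK -!mulgA; rewrite !mulgA in Hi *.
  apply/allpairsP; exists (t, i); split; rewrite ?mem_enum // inE.
  apply/asboolP => finHi; apply: not_cov; exists i => //.
  move: (_ * y)%g Dty Hi => d /(_ i finHi) Hd Hi.
  have := subgroupM (sgH i) Hi (subgroupV (sgH i) Hd).
  by rewrite -!mulgA mulgV mulg1.
by rewrite inE => /asboolP.
Qed.

End Neumann.

(** * Coverings of abelian groups *)

Section Abelian.
Variable G : groupType.
Hypothesis cGG : forall x y : G, commute x y.

(** [G / L] is realized as the permutations of the cosets of [L] induced by
    translations. *)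
Lemma finite_quotient (L : set G) : is_subgroup L -> finite_index L ->
  exists (gT : finGroupType) (pi : G -> gT),
    {morph pi : x y / (x * y)%g} /\ (forall x y, pi x = pi y <-> L (x^-1 * y)%g).
Proof.
move=> sgL finL; have [T [c [r [cL rK]]]] := left_cosets_classes sgL finL.
have cM x y z : L (y^-1 * z)%g -> c (x * y)%g = c (x * z)%g.
  by move=> Lyz; apply/cL; rewrite invgM -mulgA mulKg.
have cr x y : c (x * r (c y))%g = c (x * y)%g by apply/cM/cL; rewrite rK.
have trans_inj x : injective (fun t => c (x * r t)%g).
  by move=> t u /cL; rewrite invgM -mulgA mulKg => /cL; rewrite !rK.
pose pi x : {perm T} := perm (trans_inj x).
exists {perm T}, pi; split=> [x y|x y].
  by apply/permP => t; rewrite permM !permE /= cr mulgA (cGG y x).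
split=> [/permP/(_ (c 1%g))|Lxy].
  by rewrite !permE /= !cr !mulg1 => /cL.
apply/permP => t; rewrite !permE /=; apply/cL.
by rewrite invgM -mulgA (mulgA x^-1%g) (cGG _ (r t)) mulgA mulVg mul1g.
Qed.

Lemma group_image (gT : finGroupType) (pi : G -> gT) (M : set G) :
    {morph pi : x y / (x * y)%g} -> is_subgroup M ->
  exists Q : {group gT}, forall y, y \in Q <-> exists2 x, M x & pi x = y.
Proof.
move=> piM sgM; pose Q := [set y | `[< exists2 x, M x & pi x = y >]]%SET.
have pi1 : pi 1%g = 1%g by apply: (mulgI (pi 1%g)); rewrite -piM !mulg1.
have QP y : y \in Q <-> exists2 x, M x & pi x = y by rewrite inE; split=> /asboolP.
have gQ : group_set Q.
  apply/group_setP; split=> [|x y /QP[u Mu <-] /QP[v Mv <-]].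
    by apply/QP; exists 1%g => //; apply: subgroup1.
  by apply/QP; exists (u * v)%g => //; apply: subgroupM.
by exists (group gQ).
Qed.

Lemma is_subgroupT : is_subgroup [set: G]. Proof. by []. Qed.

(** Together with [K] the cosets cover [G]; the option type below indexes this
    covering, [None] standing for [K].  Only [K] contains [1], so [K] survives when
    the subgroups of infinite index are dropped.  The quotient by the intersection
    [L] of the remaining subgroups is finite, and membership in any of them can be
    tested there. *)
Theorem cosets_missing1_index (I : finType) (b : I -> G) (H : I -> set G)
    (K : set G) :
    (forall i, is_subgroup (H i)) -> is_subgroup K ->
    (forall i, ~ H i (b i)) ->
    (forall x, ~ K x -> exists i, H i ((b i)^-1 * x)%g) ->
  [/\ finite_index K, subgroup_index K <= 2 ^ #|I|
    & mycielski (subgroup_index K) <= #|I|].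
Proof.
move=> sgH sgK notHb cov.
pose HK o := if o is Some i then H i else K.
pose bK o := if o is Some i then b i else 1%g.
have sgHK o : is_subgroup (HK o) by case: o.
have covHK x : exists o, HK o ((bK o)^-1 * x)%g.
  have [Kx|/cov[i Hi]] := pselect (K x); last by exists (Some i).
  by exists None; rewrite /= invg1 mul1g.
have fin_cov := neumann_cover sgHK covHK.
have finK : finite_index K.
  have [[i|] //= _] := fin_cov 1%g; rewrite mulg1 => /(subgroupV (sgH i)).
  by rewrite invgK => /notHb.
pose L := \bigcap_(o in [set o | finite_index (HK o)]) HK o.
have sgL : is_subgroup L by apply: is_subgroup_bigcap.
have finL : finite_index L by apply: finite_index_bigcap.
have [gT [pi [piM piL]]] := finite_quotient sgL finL.
have [Q QP] := group_image piM is_subgroupT.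
have [QK QKP] := group_image piM sgK.
pose I' := {i : I | `[< finite_index (H i) >]}.
have /fin_all_exists[QH QHP] (i : I') := group_image piM (sgH (val i)).
have Qpi x : pi x \in Q by apply/QP; exists x.
have LK x : L x -> K x by move/(_ None); apply.
have LH (i : I') x : L x -> H (val i) x.
  by move/(_ (Some (val i))); apply; apply/asboolP/(valP i).
have mem_im M (QM : {group gT}) x : is_subgroup M -> (forall y, L y -> M y) ->
    (forall y, y \in QM <-> exists2 x, M x & pi x = y) -> (pi x \in QM) <-> M x.
  move=> sgM LM QMP; split=> [/QMP[y My /piL/LM Myx]|Mx]; last first.
    by apply/QMP; exists x.
  by have := subgroupM sgM My Myx; rewrite mulVKg.
have memK x := mem_im K QK x sgK LK QKP.
have memH i x := mem_im (H (val i)) (QH i) x (sgH (val i)) (LH i) (QHP i).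
have pi1 : pi 1%g = 1%g by apply: (mulgI (pi 1%g)); rewrite -piM !mulg1.
have piV x : pi x^-1%g = (pi x)^-1%g.
  by apply: (mulgI (pi x)); rewrite -piM !mulgV.
have indexK : subgroup_index K = #|Q : QK|%g.
  rewrite -card_lcosets.
  apply: (subgroup_index_fibers (f := fun x => (pi x *: QK)%g)) => [x y|t].
    rewrite -memK piM piV -mem_lcoset.
    by split=> [->|/lcoset_eqP //]; apply: lcoset_refl.
  split=> [/imsetP[y /QP[x _ <-] ->]|[x <-]]; first by exists x; rewrite lcosetE.
  by apply/imsetP; exists (pi x); rewrite ?lcosetE.
have abelQ : abelian Q.
  apply/centsP => _ /QP[x _ <-] _ /QP[y _ <-].
  by rewrite /commute -!piM cGG.
have sub_im M (QM : {group gT}) :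
    (forall y, y \in QM <-> exists2 x, M x & pi x = y) -> QM \subset Q.
  by move=> QMP; apply/fintype.subsetP => _ /QMP[x _ <-].
have [||||le_index le_f] := @cosets_missing1_bounds gT Q QK abelQ
    (sub_im _ _ QKP) I' (fun i => pi (b (val i))) QH.
- by move=> i; apply: sub_im (QHP i).
- by move=> i.
- by move=> i; apply/negP => /memH; apply: notHb.
- move=> _ /finset.setDP[/QP[x _ <-] /negP notKx].
  have [[i|] finH Hx] := fin_cov x; last first.
    by case: notKx; apply/memK; move: Hx; rewrite /= invg1 mul1g.
  exists (exist _ i (introT (asboolP _) finH)).
  by rewrite mem_lcoset -piV -piM; apply/memH.
have leI : #|{: I'}| <= #|I| by rewrite card_sig max_card.
split=> //; rewrite indexK; last exact: leq_trans le_f leI.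
by apply: leq_trans le_index _; rewrite leq_exp2l.
Qed.

End Abelian.

(** * Covering functions *)

Lemma is_subgroup_groupClosed (G : groupType) (S : groupClosed G) :
  is_subgroup [set` S].
Proof. by split=> [|x y Sx Sy] /=; rewrite ?gpred1 // gpredM // gpredV. Qed.

Lemma covering_fun_lift (G : groupType) (k : nat) (a : 'I_k -> G)
    (H : 'I_k -> groupClosed G) (t : 'I_k) (x : G) :
  covering_fun a H x = (x \in left_coset (a t) [set` H t]) +
    covering_fun (fun s => a (lift t s)) (fun s => H (lift t s)) x.
Proof.
rewrite /covering_fun -!sum1_card big_mkcond /= (bigD1_ord t) //=; congr (_ + _).
by rewrite [RHS]big_mkcond.
Qed.

(** The translates by [x^-1] of the [k - m] cosets that do not contain [x] cover
    the complement of [K]: for [y] outside [K], the point [x * y] lies outside one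
    of the cosets containing [x], but is still covered [m] times. *)
Lemma cover_point_bounds (G : groupType) (m k : nat) (a : 'I_k -> G)
    (H : 'I_k -> groupClosed G) (x : G) (K : set G) :
    (forall y z : G, commute y z) -> is_cover m a H -> covering_fun a H x = m ->
    is_subgroup K -> local_intersection a H x `<=` K ->
  [/\ finite_index K, subgroup_index K <= 2 ^ (k - m)
    & m + mycielski (subgroup_index K) <= k].
Proof.
move=> cGG cov wx sgK sHK.
pose A y := [pred s | y \in left_coset (a s) [set` H s]].
have AE y s : (s \in A y) = ((a s)^-1 * y \in H s)%g.
  rewrite inE left_cosetE /=; apply/idP/idP => [/set_mem //|Hy]; exact/mem_set.
have cardA : #|A x| = m by [].
pose I := {s | s \notin A x}.
have cardI : #|{: I}| = k - m.
  by rewrite card_sig -cardA -[k in k - _]card_ord -(cardC (A x)) addKn.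
have le_mk : m <= k by rewrite -cardA -[k in _ <= k]card_ord max_card.
have [] := @cosets_missing1_index G cGG I (fun i => x^-1 * a (val i))%g
    (fun i => [set` H (val i)]) K.
- by move=> i; apply: is_subgroup_groupClosed.
- by [].
- move=> i /= Hi; have /negP[] := valP i; rewrite AE.
  by have := Hi; rewrite -gpredV invgM invgK.
- move=> y notKy.
  have [s Axs notHy] : exists2 s, s \in A x & y \notin H s.
    apply: contrapT => allH; apply/notKy/sHK => s Axs /=.
    apply: contraPT allH => notHy; apply; exists s => //; exact/mem_set.
  have [i Ai notAi] : exists2 i, i \in A (x * y)%g & i \notin A x.
    have : ~~ (A (x * y)%g \subset A x).
      apply/negP => sub; have : m < m; last by rewrite ltnn.
      rewrite -{2}cardA; apply: leq_ltn_trans (cov (x * y)%g) _.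
      apply: proper_card; rewrite properE sub; apply/subsetPn; exists s => //.
      move: Axs; rewrite !AE => Hax; apply: contra notHy => Haxy.
      by rewrite -[y](mulKg ((a s)^-1 * x)%g) -mulgA gpredM ?gpredV.
    by case/subsetPn => i ? ?; exists i.
  exists (exist _ i notAi); rewrite /= invgM invgK -mulgA.
  by move: Ai; rewrite AE.
rewrite cardI => finK leN lef; split=> //.
by rewrite -(subnKC le_mk) leq_add2l.
Qed.

(** * Coverings attaining the bounds *)

Lemma mycielski_widen n (s : seq nat) :
  uniq s -> {subset primes n <= s} ->
  mycielski n = \sum_(p <- s) logn p n * (p - 1).
Proof.
move=> us sub; rewrite (bigID (mem (primes n))) /= [X in _ + X]big1 ?addn0.
  rewrite -big_filter; apply/perm_big/uniq_perm.
  - exact: primes_uniq.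
  - exact: filter_uniq.
  by move=> p; rewrite mem_filter andb_idr // => /sub.
by move=> p; rewrite -logn_gt0 lt0n negbK => /eqP ->.
Qed.

Lemma mycielskiM m n :
  0 < m -> 0 < n -> mycielski (m * n) = mycielski m + mycielski n.
Proof.
move=> m0 n0; have subM p := primesM p m0 n0.
rewrite [mycielski m](mycielski_widen (primes_uniq (m * n))) => [|p]; last first.
  by rewrite subM => ->.
rewrite [mycielski n](mycielski_widen (primes_uniq (m * n))) => [|p]; last first.
  by rewrite subM => ->; rewrite orbT.
by rewrite -big_split; apply: eq_bigr => p _; rewrite lognM // mulnDl.
Qed.

Lemma mycielski_prime p : prime p -> mycielski p = p.-1.
Proof.
move=> p_pr; rewrite /mycielski primes_prime // big_seq1.
by rewrite logn_prime // eqxx mul1n subn1.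
Qed.

Definition has_punctured_cover (n c : nat) : Prop :=
  exists (gT : finGroupType) (I : finType) (b : I -> gT) (H : I -> {group gT}),
    [/\ #|gT| = n, #|I| = c, forall x y : gT, commute x y,
        forall i, b i \notin H i
      & forall x, x != 1%g -> exists i, ((b i)^-1 * x)%g \in H i].

Lemma punctured_cover_singletons n : 0 < n -> has_punctured_cover n n.-1.
Proof.
case: n => // n _; exists 'I_n.+1, {x : 'I_n.+1 | x != 1%g}, val, (fun=> 1%G).
split=> [||x y|[x x1]|x x1] /=; rewrite ?card_ord //.
- by rewrite card_sig cardC1 card_ord.
- exact: Zp_addC.
- by rewrite inE.
- by exists (exist _ x x1); rewrite mulVg inE.
Qed.

(** An element [(x1, x2) != 1] lies in a coset [(b1 i * H1 i) x gT2] if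
    [x1 != 1], and in a coset [gT1 x (b2 i * H2 i)] otherwise. *)
Lemma punctured_coverM n1 c1 n2 c2 :
  has_punctured_cover n1 c1 -> has_punctured_cover n2 c2 ->
  has_punctured_cover (n1 * n2) (c1 + c2).
Proof.
move=> [gT1 [I1 [b1 [H1 [<- <- cG1 notH1 cov1]]]]].
move=> [gT2 [I2 [b2 [H2 [<- <- cG2 notH2 cov2]]]]].
exists (gT1 * gT2)%type, (I1 + I2)%type,
  (fun i => match i with inl j => (b1 j, 1) | inr j => (1, b2 j) end)%g,
  (fun i => match i with inl j => setX_group (H1 j) [group of [set: gT2]]
                       | inr j => setX_group [group of [set: gT1]] (H2 j) end).
split; rewrite ?card_prod ?card_sum //.
- by case=> x1 x2 [y1 y2]; congr pair; [apply: cG1|apply: cG2].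
- by case=> i; rewrite !inE /= ?andbT.
- case=> x1 x2 x12; have [x1E|/cov1[i Hi]] := eqVneq x1 1%g; last first.
    by exists (inl i); rewrite !inE /= andbT.
  have /cov2[i Hi] : x2 != 1%g by apply: contraNneq x12 => ->; rewrite x1E.
  by exists (inr i); rewrite !inE.
Qed.

Lemma punctured_cover_exp2 n : has_punctured_cover (2 ^ n) n.
Proof.
elim: n => [|n IHn]; first exact: punctured_cover_singletons.
rewrite expnS -[n.+1]add1n; apply: punctured_coverM IHn.
exact: punctured_cover_singletons.
Qed.

Lemma punctured_cover_mycielski n : 0 < n -> has_punctured_cover n (mycielski n).
Proof.
have [N] := ubnP n; elim: N n => // N IHN n /ltnSE le_nN n0.
have [n1|n1] := leqP n 1.
  have -> : n = 1 by apply/eqP; rewrite eqn_leq n1.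
  by rewrite /mycielski big_nil; apply: punctured_cover_singletons.
have p_pr := pdiv_prime n1; have p1 := prime_gt1 p_pr; have p0 := prime_gt0 p_pr.
have nE : n = pdiv n * (n %/ pdiv n) by rewrite mulnC divnK ?pdiv_dvd.
have q0 : 0 < n %/ pdiv n by rewrite divn_gt0 // dvdn_leq ?pdiv_dvd.
rewrite nE mycielskiM // mycielski_prime //.
apply: punctured_coverM; first exact: punctured_cover_singletons.
by apply: IHN => //; apply: leq_trans le_nN; rewrite ltn_Pdiv.
Qed.

Section MemGroup.
Variables (gT : finGroupType) (H : {group gT}).
Definition mem_group : {pred gT} := fun x => x \in H.
Let mem_group1 : 1%g \in mem_group. Proof. exact: group1. Qed.
Let mem_groupM : mulg_closed mem_group. Proof. by move=> x y; apply: groupM. Qed.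
Let mem_groupV : invg_closed mem_group.
Proof. by move=> x Hx; rewrite unfold_in groupV. Qed.
Definition groupClosed_of_group : groupClosed gT :=
  HB.pack mem_group (isMul1Closed.Build gT mem_group mem_group1)
    (isMulClosed.Build gT mem_group mem_groupM)
    (isInvClosed.Build gT mem_group mem_groupV).
End MemGroup.

(** With [m.-1] copies of the whole group and the trivial subgroup added, the
    point [1] is covered exactly [m] times and every other point at least [m]
    times, so the trivial subgroup, of index [n], cannot be deleted. *)
Lemma sharp_cover (m n c : nat) : 0 < m -> has_punctured_cover n c ->
  exists (G : groupType) (a : 'I_(m + c) -> G) (H : 'I_(m + c) -> groupClosed G)
      (t : 'I_(m + c)),
    [/\ forall x y : G, commute x y, is_cover m a H, fails_without m a H t,
        finite_index [set` H t] & subgroup_index [set` H t] = n].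
Proof.
move=> m0 [gT [I [b [H [<- <- cGG notH cov]]]]].
pose aT (u : 'I_m + I) := if u is inr i then b i else 1%g.
pose HT (u : 'I_m + I) : {group gT} :=
  match u with inl i => if val i == 0 then 1%G else [set: gT]%G | inr i => H i end.
have cardT : m + #|I| = #|{: 'I_m + I}| by rewrite card_sum card_ord.
pose e (s : 'I_(m + #|I|)) := enum_val (cast_ord cardT s).
pose e' u := cast_ord (esym cardT) (enum_rank u).
have eK : cancel e e' by move=> s; rewrite /e' /e enum_valK cast_ordK.
have e'K : cancel e' e by move=> u; rewrite /e' /e cast_ordKV enum_rankK.
pose a s := aT (e s).
pose Hk s := groupClosed_of_group (HT (e s)).
pose i0 := Ordinal m0.
exists gT, a, Hk, (e' (inl i0)).
have wE x : covering_fun a Hk x =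
    (x == 1%g) + m.-1 + #|[pred i | ((b i)^-1 * x)%g \in H i]|.
  have cosetE s : (x \in left_coset (a s) [set` Hk s]) =
      ((aT (e s))^-1 * x \in HT (e s))%g.
    rewrite left_cosetE; apply/idP/idP => [/set_mem //|Hx]; exact/mem_set.
  rewrite /covering_fun -sum1_card (eq_bigl _ _ cosetE).
  rewrite (reindex e') /=; last by exists e => ? _.
  under eq_bigl do rewrite e'K.
  rewrite big_sumType /=; congr (_ + _); last by rewrite sum1_card.
  rewrite big_mkcond (bigD1 i0) //= invg1 mul1g inE; congr (_ + _).
  rewrite (eq_bigr (fun=> 1)) => [|i]; first by rewrite sum1_card cardC1 card_ord.
  rewrite -val_eqE /= => /negPf i_neq0.
  by rewrite i_neq0 inE.
have w1 : covering_fun a Hk 1%g = m.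
  rewrite wE eqxx add1n prednK // eq_card0 ?addn0 // => i.
  by rewrite !inE mulg1 groupV (negPf (notH i)).
have HkE : [set` Hk (e' (inl i0))] = [set 1%g : gT].
  by apply/seteqP; split=> x; rewrite /= unfold_in /mem_group e'K /= inE => /eqP.
have sepP x y : x = y <-> [set` Hk (e' (inl i0))] (x^-1 * y)%g.
  rewrite HkE; split=> [->|/= xy]; first by rewrite /= mulVg.
  by rewrite -[y](mulKVg x) xy mulg1.
split=> //.
- move=> x; rewrite wE; have [_|/cov[i Hi]] := eqVneq x 1%g.
    by rewrite add1n prednK // leq_addr.
  rewrite add0n -[leqLHS]prednK // -addn1 leq_add2l; apply/card_gt0P; by exists i.
- move=> /(_ 1%g); rewrite leqNgt => /negP; apply.
  have := covering_fun_lift a Hk (e' (inl i0)) 1%g; rewrite w1 => w1E.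
  rewrite [X in _ < X]w1E HkE (_ : (_ \in _) = true) ?add1n //.
  by apply/mem_set; rewrite left_cosetE /= /a e'K /= mulg1 invg1.
- apply: (finite_index_separated (is_subgroup_groupClosed _) (f := id)) => x y.
  by move/sepP.
- rewrite (subgroup_index_fibers (f := id) (A := [set: gT]%SET) sepP) ?cardsT //.
  move=> x.
  by split=> // _; exists x.
Qed.

Theorem theorem1p3 (m : nat) (m_gt0 : 0 < m) :
  (forall (G : groupType) (k : nat)
      (a : 'I_k -> G) (H : 'I_k -> groupClosed G),
    (forall x y : G, commute x y) ->
    is_cover m a H ->
    (forall x : G, covering_fun a H x = m ->
      let N := subgroup_index (local_intersection a H x) in
      [/\ finite_index (local_intersection a H x),
          N <= 2 ^ (k - m)
        & m + mycielski N <= k]) /\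
    (forall t : 'I_k, fails_without m a H t ->
      let n := subgroup_index [set` H t] in
      [/\ finite_index [set` H t],
          n <= 2 ^ (k - m)
        & m + mycielski n <= k]))
  /\
  (forall k : nat, m <= k ->
    exists (G : groupType) (a : 'I_k -> G) (H : 'I_k -> groupClosed G)
      (t : 'I_k),
      [/\ forall x y : G, commute x y,
          is_cover m a H,
          fails_without m a H t,
          finite_index [set` H t]
        & subgroup_index [set` H t] = 2 ^ (k - m)])
  /\
  (forall n : nat, 0 < n ->
    exists (G : groupType) (k : nat) (a : 'I_k -> G)
      (H : 'I_k -> groupClosed G) (t : 'I_k),
      [/\ forall x y : G, commute x y,
          is_cover m a H,
          fails_without m a H t,
          finite_index [set` H t]
        & subgroup_index [set` H t] = n /\ k = m + mycielski n]).
Proof.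
split; [|split].
- move=> G k a H cGG cov; split=> [x wx N|t not_cov n].
    apply: (cover_point_bounds cGG cov wx) => //.
    by apply: is_subgroup_bigcap => s _; apply: is_subgroup_groupClosed.
  have [x lt_x] : exists x,
      covering_fun (fun s => a (lift t s)) (fun s => H (lift t s)) x < m.
    apply: contrapT => no_x; apply: not_cov => x.
    by rewrite leqNgt; apply/negP => lt_x; apply: no_x; exists x.
  (* deleting the coset of index [t] lowers the count at [x] below [m], so this
     coset contains [x] and the count was exactly [m] *)
  have := cov x; have := covering_fun_lift a H t x.
  case: (boolP (x \in _)) => [xt|_] wE.
    move=> le_m; apply: (cover_point_bounds (x := x) cGG cov).
    - by apply/eqP; rewrite eqn_leq le_m wE add1n lt_x.
    - exact: is_subgroup_groupClosed.
    - by move=> y /(_ t); apply; apply: set_mem.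
  by rewrite wE add0n leqNgt lt_x.
- move=> k le_mk; rewrite -(subnKC le_mk) addKn.
  exact: sharp_cover (punctured_cover_exp2 _).
- move=> n n0.
  have [G [a [H [t [cGG cov fails finH index_t]]]]] :=
    sharp_cover m_gt0 (punctured_cover_mycielski n0).
  by exists G, (m + mycielski n), a, H, t.
Qed.
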